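(* Let $S$ be a finite semigroup whose $\mathcal{J}$-classes form a chain $J_\epsilon<\dots<J_k$ (indexed by consecutive integers $\epsilon,\dots,k$). For $i\in\{\epsilon,\dots,k\}$ let $\mathcal{C}_i$ be the restriction of the Cayley table presentation of $S$ to $U_i=J_i\cup\dots\cup J_k$. Then the relational depth of $S$ is $k-i+1$, where $i$ is the largest number in $\{\epsilon,\dots,k\}$ for which $\mathcal{C}_i$ defines $S$.
   Context: A semigroup presentation is a pair $\langle A\mid R\rangle$ with $A$ a finite alphabet and $R\subseteq A^+\times A^+$ a set of defining relations, a pair $(u,v)$ being written $u=v$; it is a presentation for a semigroup $S$ (it defines $S$) if $S\cong A^+/R^\sharp$, where $R^\sharp$ is the smallest congruence on $A^+$ containing $R$. Via this isomorphism each word in $A^+$ represents an element of $S$. For $U\subseteq S$ the restriction of the Cayley table presentation of $S$ to $U$ is $$\mathcal{C}_{S,U}=\langle x_s\ (s\in U)\mid x_sx_t=x_{st}\ (s,t,st\in U)\rangle ,$$ where the generator $x_s$ represents $s$; thus ''$\mathcal{C}_{S,U}$ defines $S$'' means that the homomorphism from the free semigroup on $\{x_s:s\in U\}$ to $S$ given by $x_s\mapsto s$ is surjective and its kernel is the congruence generated by the listed relations. Relational depth of $S$: the depth of $J_i$ is $k-i+1$; the depth of an element is the depth of its $\mathcal{J}$-class; given a presentation $\langle A\mid R\rangle$ for $S$, the depth of a word is the depth of the element it represents, the depth of a relation $u=v$ in $R$ is the common depth of $u$ and $v$, and the depth of the presentation is the maximal depth of a relation in $R$. The relational depth of $S$ is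 the minimum of the depths of all presentations for $S$. *)

(* Defs.v *)
From HB Require Import structures.
From mathcomp Require Import all_boot all_order.
From mathcomp Require Import ssralg ssrnum ssrint.
From mathcomp Require Import boolp.

Set Implicit Arguments.
Unset Strict Implicit.
Unset Printing Implicit Defensive.

Import Order.TTheory GRing.Theory Num.Theory.
Local Open Scope group_scope.
Local Open Scope quotient_scope.

#[short(type="finSemigroupType")]
HB.structure Definition FinSemigroup := {S of Semigroup S & Finite S}.

(* An element of A^+ is stored as its first letter and the rest of the word. *)
Record word (A : Type) : Type := Word { whead : A; wtail : seq A }.

Definition letter (A : Type) (a : A) : word A := Word a [::].

Definition wcat (A : Type) (u v : word A) : word A :=
  Word (whead u) (wtail u ++ whead v :: wtail v).

Definition word_pair (A : Type) (u : word A) : A * seq A := (whead u, wtail u).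
Definition pair_word (A : Type) (p : A * seq A) : word A := Word p.1 p.2.

Lemma word_pairK (A : Type) : cancel (@word_pair A) (@pair_word A).
Proof. by case. Qed.

HB.instance Definition _ (A : choiceType) :=
  Choice.copy (word A) (can_type (@word_pairK A)).

Lemma wcatA (A : Type) : associative (@wcat A).
Proof. by move=> [a u] [b v] [c w]; rewrite /wcat /= -catA. Qed.

HB.instance Definition _ (A : choiceType) :=
  isSemigroup.Build (word A) (@wcatA A).

(* The homomorphism A^+ -> S extending f : A -> S. *)
Definition weval (A : Type) (S : magmaType) (f : A -> S) (w : word A) : S :=
  foldl (fun s a => s * f a) (f (whead w)) (wtail w).

Lemma wevalM (A : choiceType) (S : semigroupType) (f : A -> S) :
  {morph weval f : u v / u * v}.
Proof.
move=> [a u] [b v]; rewrite /weval /= foldl_cat /=.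
elim/last_ind: v => // v c IHv; rewrite -!cats1 !foldl_cat /= IHv.
by rewrite mulgA.
Qed.

Definition relations (A : Type) : Type := word A -> word A -> Prop.

Section Presentation.
Variable A : choiceType.
Implicit Types R C : relations A.

Record congruence C : Prop := Congruence {
  congr_refl : forall u, C u u;
  congr_sym : forall u v, C u v -> C v u;
  congr_trans : forall u v w, C u v -> C v w -> C u w;
  congr_mul : forall u v u' v', C u v -> C u' v' -> C (u * u') (v * v') }.

(* R^# : the intersection of all congruences on A^+ containing R. *)
Definition gen_congr R : relations A := fun u v =>
  forall C, congruence C -> (forall x y, R x y -> C x y) -> C u v.

Lemma gen_congrP R : congruence (gen_congr R).
Proof.
split=> [u|u v uv|u v w uv vw|u v u' v' uv uv'] C cC RC.
- exact: congr_refl.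
- by apply: congr_sym => //; apply: uv.
- by apply: (congr_trans cC (uv C cC RC)); apply: vw.
- by apply: congr_mul => //; [apply: uv | apply: uv'].
Qed.

Definition gen_congrb R : rel (word A) := fun u v => `[< gen_congr R u v >].

Lemma gen_congrb_refl R : reflexive (gen_congrb R).
Proof. by move=> u; apply/asboolP; apply: congr_refl (gen_congrP R) u. Qed.

Lemma gen_congrb_sym R : symmetric (gen_congrb R).
Proof.
by move=> u v; apply/idP/idP=> /asboolP uv; apply/asboolP;
   apply: congr_sym uv; apply: gen_congrP.
Qed.

Lemma gen_congrb_trans R : transitive (gen_congrb R).
Proof.
move=> v u w /asboolP uv /asboolP vw; apply/asboolP.
exact: congr_trans (gen_congrP R) _ _ _ uv vw.
Qed.

Canonical gen_congr_equiv R :=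
  EquivRel (gen_congrb R) (@gen_congrb_refl R) (@gen_congrb_sym R)
           (@gen_congrb_trans R).

(* The semigroup A^+ / R^#. *)
Definition presented R : Type := {eq_quot gen_congrb R}.

HB.instance Definition _ R := Choice.on (presented R).

Definition wclass R (u : word A) : presented R :=
  \pi_{eq_quot gen_congrb R} u.

Lemma wclassP R u v : wclass R u = wclass R v <-> gen_congr R u v.
Proof.
by split=> [/eqmodP /asboolP | uv]; last by apply/eqmodP/asboolP.
Qed.

Definition wrepr R (p : presented R) : word A :=
  repr (p : {eq_quot gen_congrb R}).

Lemma wreprK R : cancel (@wrepr R) (@wclass R).
Proof. by move=> p; rewrite /wclass /wrepr reprK. Qed.

Definition presented_mul R (p q : presented R) : presented R :=
  wclass R (wrepr p * wrepr q).

Lemma wclassM R u v :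
  presented_mul (wclass R u) (wclass R v) = wclass R (u * v).
Proof.
apply/wclassP; apply: (congr_mul (gen_congrP R)); apply/wclassP; exact: wreprK.
Qed.

Lemma presented_mulA R : associative (@presented_mul R).
Proof.
by move=> p q r; rewrite -[p]wreprK -[q]wreprK -[r]wreprK !wclassM mulgA.
Qed.

HB.instance Definition _ R :=
  isSemigroup.Build (presented R) (@presented_mulA R).

End Presentation.

Section Green.
Variable S : finSemigroupType.
Implicit Types s t : S.

(* The principal ideal S^1 s S^1, written without adjoining an identity. *)
Definition principal_ideal s : {set S} :=
  [set x | [|| x == s, [exists a, x == a * s], [exists b, x == s * b] |
               [exists a, [exists b, x == a * s * b]]]].

Definition Jclass s : {set S} :=
  [set t | principal_ideal t == principal_ideal s].

(* The strict order on J-classes. *)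
Definition Jlt (X Y : {set S}) : Prop :=
  forall s t, s \in X -> t \in Y ->
    principal_ideal s \proper principal_ideal t.

(* The J-classes of S are J_eps < ... < J_k; values of J outside [eps, k] are
   irrelevant. *)
Record Jchain (eps k : int) (J : int -> {set S}) : Prop := MkJchain {
  Jchain_ne : (eps <= k)%R;
  Jchain_class : forall i : int, (eps <= i <= k)%R -> exists s, J i = Jclass s;
  Jchain_cover : forall s, exists2 i : int, (eps <= i <= k)%R & J i = Jclass s;
  Jchain_lt : forall i j : int,
    (eps <= i)%R -> (i < j)%R -> (j <= k)%R -> Jlt (J i) (J j) }.

End Green.

Section CayleyRestriction.
Variables (S : finSemigroupType) (U : {set S}).

(* The alphabet {x_s : s in U} is the subtype {s in U}, with x_s = letter s. *)
Definition cayley_rel : relations {s in U} := fun u v =>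
  exists s t r : {s in U},
    [/\ val s * val t = val r, u = letter s * letter t & v = letter r].

Definition cayley_defines : Prop :=
  (forall x : S, exists w : word {s in U}, weval val w = x) /\
  (forall u v : word {s in U},
     weval val u = weval val v <-> gen_congr cayley_rel u v).

End CayleyRestriction.

Section Depth.
Variables (S : finSemigroupType) (eps k : int) (J : int -> {set S}).

Definition elt_depth (s : S) (d : int) : Prop :=
  exists i : int, [/\ (eps <= i <= k)%R, s \in J i & d = (k - i + 1)%R].

(* The presentation <A | R> comes with an isomorphism theta : A^+/R^# -> S. *)
Section PresentationDepth.
Variables (A : finType) (R : relations A) (theta : presented R -> S).

Definition word_depth (w : word A) : int -> Prop :=
  elt_depth (theta (wclass R w)).

Definition rel_depth (u v : word A) (d : int) : Prop :=
  word_depth u d /\ word_depth v d.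

Definition pres_depth (d : int) : Prop :=
  (exists u v, R u v /\ rel_depth u v d) /\
  (forall u v d', R u v -> rel_depth u v d' -> (d' <= d)%R).

End PresentationDepth.

Definition has_pres_of_depth (d : int) : Prop :=
  exists (A : finType) (R : relations A)
         (theta : {multiplicative presented R -> S}),
    bijective theta /\ pres_depth theta d.

Definition relational_depth (d : int) : Prop :=
  has_pres_of_depth d /\
  (forall d', has_pres_of_depth d' -> (d <= d')%R).

(* U_i = J_i :|: ... :|: J_k, for i <= k. *)
Definition Jupper (i : int) : {set S} :=
  \bigcup_(m < `|k - i|%N.+1) J (i + m%:Z)%R.

End Depth.

(* Main.v *)
Require Import Defs.
From mathcomp Require Import all_boot all_order.
From mathcomp Require Import ssralg ssrnum ssrint.
From mathcomp Require Import boolp zify.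
From HB Require Import structures.
Local Open Scope ring_scope.

(** Let [A | R] present S with all relations of depth at most k - j + 1. A
    letter representing an element outside U_j occurs in no relation, so the
    number of its occurrences is invariant under R^#, which is impossible as S
    is finite; hence U_j generates S. The complement of U_j is an ideal, so a
    word whose value s lies in U_j has all its prefixes in U_j and the relations
    of C_j rewrite it to x_s. Therefore C_j proves the image of every relation
    of R, and C_j defines S. Conversely, C_i has depth at most k - i + 1. *)

(** * Words, their evaluation and congruences on them *)

Section Words.
Context {A : choiceType}.

(** [weval] is a left fold, so splitting off the last letter turns evaluation into one right
    multiplication. *)
Lemma word_rcons_ind (P : word A -> Prop) :
  (forall a, P (letter a)) ->
  (forall w a, P w -> P (w * letter a)%g) -> forall w, P w.
Proof.
move=> Pletter Prcons [a s]; elim/last_ind: s => [|s b IHs]; first exact: Pletter.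
by rewrite -cats1; apply: (Prcons (Word a s) b).
Qed.

Lemma eq_weval {S : magmaType} (f g : A -> S) : f =1 g -> weval f =1 weval g.
Proof.
move=> fg [a s]; rewrite /weval /= fg.
by elim: s (g a) => //= b s IHs x; rewrite fg IHs.
Qed.

Lemma weval_morph {S T : semigroupType} (h : S -> T) (f : A -> S) :
  {morph h : x y / (x * y)%g} -> forall w, h (weval f w) = weval (h \o f) w.
Proof.
move=> hM; elim/word_rcons_ind => [//|w a IHw].
by rewrite !wevalM hM IHw.
Qed.

Lemma weval_letter (w : word A) : weval (@letter A) w = w.
Proof. by elim/word_rcons_ind: w => [//|w a IHw]; rewrite wevalM IHw. Qed.

(** Fed to [gen_congr], such a kernel carries an equality of values from the relations to all their
    consequences. *)
Lemma congruence_eval {S : semigroupType} {h : word A -> S} :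
  {morph h : u v / (u * v)%g} -> congruence (fun u v => h u = h v).
Proof. by move=> hM; split=> [//|//|u v w -> //|u v u' v']; rewrite !hM => -> ->. Qed.

Lemma congruence_preim {B : choiceType} {h : word A -> word B} {C : relations B} :
  {morph h : u v / (u * v)%g} -> congruence C -> congruence (fun u v => C (h u) (h v)).
Proof.
move=> hM [Cr Cs Ct Cm]; split=> [u|u v|u v w|u v u' v'].
- exact: Cr.
- exact: Cs.
- exact: Ct.
- by rewrite !hM; apply: Cm.
Qed.

Lemma congr_weval {B : choiceType} {C : relations B} (f g : A -> word B) :
  congruence C -> (forall a, C (f a) (g a)) ->
  forall w, C (weval f w) (weval g w).
Proof.
move=> cC Cfg; elim/word_rcons_ind => [a|w a IHw]; first exact: Cfg.
by rewrite !wevalM; exact (congr_mul cC IHw (Cfg a)).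
Qed.

Lemma gen_congr_rel {R : relations A} {u v} : R u v -> gen_congr R u v.
Proof. by move=> Ruv C _; apply. Qed.

End Words.

(** * Restricted Cayley tables over a set whose complement is an ideal *)

Definition factor_closed {S : finSemigroupType} (U : {set S}) : Prop :=
  forall s t, (s * t)%g \in U -> s \in U /\ t \in U.

Lemma weval_factor_closed {S : finSemigroupType} {U : {set S}} {A : choiceType}
    {f : A -> S} {w : word A} :
  factor_closed U -> weval f w \in U -> {in whead w :: wtail w, forall a, f a \in U}.
Proof.
move=> Ufc; elim/(@word_rcons_ind A): w => [b|w b IHw] wU a.
  by rewrite inE => /eqP->.
move: wU; rewrite wevalM => /Ufc[/IHw{}IHw bU].
rewrite [_ :: _]/= -cat_cons mem_cat => /orP[/IHw//|].
by rewrite inE => /eqP->.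
Qed.

Lemma cayley_sound {S : finSemigroupType} {U : {set S}} (u v : word {s in U}) :
  gen_congr (@cayley_rel S U) u v -> weval val u = weval val v.
Proof.
move=> /(_ _ (congruence_eval (wevalM _))); apply.
by move=> _ _ [s [t [r [str -> ->]]]]; rewrite wevalM.
Qed.

Lemma cayley_collapse {S : finSemigroupType} {U : {set S}} (w : word {s in U})
    (r : {s in U}) :
  factor_closed U -> weval val w = val r ->
  gen_congr (@cayley_rel S U) w (letter r).
Proof.
move=> Ufc; have cC := gen_congrP (@cayley_rel S U).
elim/(@word_rcons_ind {s in U}): w r => [s r sr|w s IHw r].
  by have -> : s = r by [apply: val_inj]; apply: (congr_refl cC).
rewrite wevalM => wsr; have [wU _] : weval val w \in U /\ val s \in U.
  by apply: Ufc; rewrite [X in X \in _]wsr; apply: valP.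
(* The value of the prefix is again a generator [t]: induction collapses the prefix to [t], and one
   entry of the table absorbs the last letter. *)
pose t : {s in U} := Sub (weval val w) wU.
apply: (@congr_trans _ _ cC _ (letter t * letter s)%g).
  by apply: (congr_mul cC); [apply: IHw | apply: (congr_refl cC)].
by apply: gen_congr_rel; exists t, s, r.
Qed.

(** Every word collapses to the letter of its value. This secures one defining index, [eps], so that
    a largest one exists. *)
Lemma cayley_defines_setT (S : finSemigroupType) (U : {set S}) :
  (forall s, s \in U) -> cayley_defines U.
Proof.
move=> UT; have cC := gen_congrP (@cayley_rel S U).
have Ufc : factor_closed U by [].
split=> [x|u v]; first by exists (letter (Sub x (UT x))).
split=> [uv|]; last exact: cayley_sound.
pose r : {s in U} := Sub (weval val u) (UT _).
apply: (@congr_trans _ _ cC _ (letter r)); first exact: cayley_collapse.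
by apply: (congr_sym cC); apply: cayley_collapse.
Qed.

(** * From a presentation with relations inside [U] to the restricted Cayley table *)

Section PresentationInUpperSet.
Context {S : finSemigroupType} {U : {set S}} {A : finType} {R : relations A}.
Context {f : A -> S}.
Hypothesis Ufc : factor_closed U.
Hypothesis f_onto : forall s, exists w, weval f w = s.
Hypothesis f_kernel : forall u v, weval f u = weval f v <-> gen_congr R u v.
Hypothesis RU : forall u v, R u v -> weval f u \in U.

Lemma presentation_letter_mem a : f a \in U.
Proof.
apply: contraT => aU; pose c (w : word A) := count_mem a (whead w :: wtail w).
have c0 w : weval f w \in U -> c w = 0%N.
  move=> wU; apply/count_memPn; apply: contra aU.
  exact: (weval_factor_closed Ufc wU).
have cM u v : c (u * v)%g = (c u + c v)%N by rewrite /c [_ :: _]/= -cat_cons count_cat.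
have c_inv u v : weval f u = weval f v -> c u = c v.
  have cC : congruence (fun u v => c u = c v).
    by split=> [//|//|? ? ? -> //|? ? ? ?]; rewrite !cM => -> ->.
  move=> /f_kernel/(_ _ cC); apply=> x y Rxy.
  (* Both sides of a relation have their value in [U], so both counts vanish. *)
  rewrite !c0 //; first by rewrite -(iffRL (f_kernel x y) (gen_congr_rel Rxy)) (RU _ _ Rxy).
  exact: RU _ _ Rxy.
(* The powers of [a] with exponents from 1 to |S| + 1 differ in their counts, so they would have
   distinct values in S. *)
pose g (n : 'I_#|S|.+1) := weval f (Word a (nseq n a)).
have /leq_card : injective g.
  move=> m n /c_inv; rewrite /c /= eqxx !count_nseq /= eqxx !mul1n => /addnI mn.
  exact: val_inj.
by rewrite card_ord ltnn.
Qed.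

Lemma cayley_defines_of_presentation : cayley_defines U.
Proof.
have cC := gen_congrP (@cayley_rel S U).
pose x a : {s in U} := Sub (f a) (presentation_letter_mem a).
pose X := weval (fun a => letter (x a)).
have X_val w : weval val (X w) = weval f w.
  by rewrite /X (weval_morph (weval val)) //; apply: wevalM.
(* The Cayley congruence pulled back along [X] contains [R]: the two sides of a relation collapse to
   the letter of their common value. *)
have X_congr u v : weval f u = weval f v -> gen_congr (@cayley_rel S U) (X u) (X v).
  move=> /f_kernel/(_ _ (congruence_preim (wevalM _) cC)); apply=> y z Ryz.
  have yz := iffRL (f_kernel y z) (gen_congr_rel Ryz).
  pose r : {s in U} := Sub (weval f y) (RU _ _ Ryz).
  apply: (@congr_trans _ _ cC _ (letter r)).
    by apply: cayley_collapse => //; rewrite X_val.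
  by apply: (congr_sym cC); apply: cayley_collapse => //; rewrite X_val -yz.
split=> [s|u v]; first by have [w ws] := f_onto s; exists (X w); rewrite X_val.
split=> [uv|]; last exact: cayley_sound.
(* [h] writes each element of [U] as a word over [A]; following it by [X] returns to the alphabet of
   [U] without changing values. *)
have [h hE] := choice (fun s : {s in U} => f_onto (val s)).
have h_val w : weval f (weval h w) = weval val w.
  by rewrite (weval_morph (weval f)); [apply: eq_weval | apply: wevalM].
have h_congr w : gen_congr (@cayley_rel S U) w (X (weval h w)).
  (* Writing [w] as the evaluation of its own letters reduces the claim to single letters, where
     [cayley_collapse] applies. *)
  rewrite -{1}[w]weval_letter (weval_morph X); last exact: wevalM.
  apply: congr_weval => // s; apply: (congr_sym cC).
  by apply: cayley_collapse => //=; rewrite X_val.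
apply: (congr_trans cC (h_congr u)).
apply: (congr_trans cC _ (congr_sym cC (h_congr v))).
by apply: X_congr; rewrite !h_val.
Qed.

End PresentationInUpperSet.

(** * The homomorphism induced on a presented semigroup *)

Section EvalPresented.
Context {A : choiceType} {R : relations A} {S : semigroupType} {f : A -> S}.
Hypothesis f_kernel : forall u v, weval f u = weval f v <-> gen_congr R u v.

(** The value is read off a chosen representative; [f_kernel] makes the choice immaterial. *)
Definition presented_eval (p : presented R) : S := weval f (wrepr p).

Lemma presented_evalE w : presented_eval (wclass R w) = weval f w.
Proof. by apply/f_kernel/wclassP; apply: wreprK. Qed.

Lemma presented_evalM : {morph presented_eval : p q / (p * q)%g}.
Proof. by move=> p q; rewrite [LHS]presented_evalE wevalM. Qed.

End EvalPresented.

(** * Chains of J-classes, upper sets and depth *)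

Section Chain.
Context {S : finSemigroupType} {eps k : int} {J : int -> {set S}}.
Hypothesis chainJ : Jchain eps k J.

Lemma mem_Jchain s : exists2 i : int, eps <= i <= k & s \in J i.
Proof.
by have [i ik Ji] := Jchain_cover chainJ s; exists i => //; rewrite Ji inE.
Qed.

Lemma Jchain_leq {s t : S} {i j : int} :
  eps <= i <= k -> eps <= j <= k -> s \in J i -> t \in J j ->
  principal_ideal s \subset principal_ideal t -> i <= j.
Proof.
move=> ik jk si tj st; rewrite Order.TotalTheory.leNgt; apply/negP=> ji.
have [ej ki] : eps <= j /\ i <= k by lia.
by have := Jchain_lt chainJ ej ji ki tj si; rewrite properE st andbF.
Qed.

Lemma Jchain_uniq (s : S) (i j : int) :
  eps <= i <= k -> eps <= j <= k -> s \in J i -> s \in J j -> i = j.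
Proof.
move=> ik jk si sj.
have := Jchain_leq ik jk si sj (subxx _).
have := Jchain_leq jk ik sj si (subxx _).
lia.
Qed.

Lemma mem_Jupper {i : int} {s : S} :
  i <= k -> reflect (exists2 m : int, i <= m <= k & s \in J m) (s \in Jupper k J i).
Proof.
move=> ik; apply: (iffP bigcupP) => [[m _ sm]|[m mk sm]].
  by exists (i + m%:Z) => //; have := ltn_ord m; lia.
have m_lt : (`|m - i|%N < `|k - i|%N.+1)%N by lia.
by exists (Ordinal m_lt) => //=; rewrite (_ : i + _ = m) //; lia.
Qed.

Lemma elt_depth_ex s : exists d, elt_depth eps k J s d.
Proof. by have [i ik si] := mem_Jchain s; exists (k - i + 1), i. Qed.

(** An element lies in only one class of the chain, so its depth is unique and bounds on it become
    membership in upper sets. *)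
Lemma elt_depth_Jupper {s : S} {d : int} :
  elt_depth eps k J s d -> eps <= k - d + 1 <= k /\
    forall j, eps <= j <= k -> (s \in Jupper k J j) = (d <= k - j + 1).
Proof.
case=> i [ik si ->]; split=> [|j jk]; first lia.
apply/mem_Jupper/idP => [|[m mk sm]|ji]; first lia.
  by rewrite (Jchain_uniq s i m) //; lia.
by exists i => //; lia.
Qed.

Lemma principal_ideal_mulr (s t : S) :
  principal_ideal (s * t)%g \subset principal_ideal s.
Proof.
apply/subsetP=> x; rewrite !inE => /or4P[/eqP->|/existsP[a /eqP->]|/existsP[b /eqP->]|].
- by apply/or4P/Or43/existsP; exists t.
- by apply/or4P/Or44/existsP; exists a; apply/existsP; exists t; rewrite mulgA.
- by apply/or4P/Or43/existsP; exists (t * b)%g; rewrite mulgA.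
case/existsP=> a /existsP[b /eqP->].
by apply/or4P/Or44/existsP; exists a; apply/existsP; exists (t * b)%g; rewrite !mulgA.
Qed.

Lemma principal_ideal_mull (s t : S) :
  principal_ideal (s * t)%g \subset principal_ideal t.
Proof.
apply/subsetP=> x; rewrite !inE => /or4P[/eqP->|/existsP[a /eqP->]|/existsP[b /eqP->]|].
- by apply/or4P/Or42/existsP; exists s.
- by apply/or4P/Or42/existsP; exists (a * s)%g; rewrite mulgA.
- by apply/or4P/Or44/existsP; exists s; apply/existsP; exists b.
case/existsP=> a /existsP[b /eqP->].
by apply/or4P/Or44/existsP; exists (a * s)%g; apply/existsP; exists b; rewrite !mulgA.
Qed.

(** Factors of a product lie J-above it, and U_i is closed upwards. *)
Lemma Jupper_factor_closed (i : int) :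
  eps <= i <= k -> factor_closed (Jupper k J i).
Proof.
move=> ik s t /mem_Jupper[|m mk stm]; first lia.
have sub_mem x : principal_ideal (s * t)%g \subset principal_ideal x ->
    x \in Jupper k J i.
  move=> sub; have [n nk xn] := mem_Jchain x.
  apply/mem_Jupper; first lia.
  have mn : m <= n by apply: Jchain_leq _ _ stm xn sub; lia.
  by exists n => //; lia.
by split; apply: sub_mem; [apply: principal_ideal_mulr | apply: principal_ideal_mull].
Qed.

Lemma cayley_defines_Jupper_min : cayley_defines (Jupper k J eps).
Proof.
apply: cayley_defines_setT => s; have [i ik si] := mem_Jchain s.
by apply/mem_Jupper; [lia | exists i].
Qed.

Lemma Jchain_inhabited {i : int} : eps <= i <= k -> exists s, s \in J i.
Proof.
by move=> ik; have [s ->] := Jchain_class chainJ ik; exists s; rewrite inE.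
Qed.

Lemma has_pres_of_depth_Jupper (i : int) :
  eps <= i <= k -> cayley_defines (Jupper k J i) ->
  has_pres_of_depth eps k J (k - i + 1).
Proof.
move=> ik [onto kernel]; set U := Jupper k J i in onto kernel.
(* With all the relations between words of value in U_i, instead of those of
   C_i only, the depth k - i + 1 is attained by a trivial relation. *)
pose R : relations {s in U} := fun u v =>
  weval val u = weval val v /\ weval val u \in U.
(* [R] contains the relations of C_i and is contained in the kernel of evaluation, which those
   relations already generate. *)
have R_kernel (u v : word {s in U}) : weval val u = weval val v <-> gen_congr R u v.
  split=> [/kernel|/(_ _ (congruence_eval (wevalM val)))]; last by apply=> x y [].
  move=> uv C cC RC; apply: uv => // x y [s [t [r [str -> ->]]]].
  apply: RC; split; first by rewrite wevalM.
  by rewrite wevalM [X in X \in _]str; apply: valP.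
pose theta := @presented_eval _ R S val.
have thetaE w : theta (wclass R w) = weval val w by apply: presented_evalE.
pose thetaM := isMultiplicative.Build _ _ theta (presented_evalM R_kernel).
pose Theta : {multiplicative presented R -> S} := HB.pack theta thetaM.
exists {s in U}, R, Theta; split.
  have [g gK] := choice onto; exists (fun s => wclass R (g s)) => [p|s].
    by rewrite -[RHS]wreprK; apply/wclassP/R_kernel; rewrite gK.
  by rewrite [LHS]thetaE gK.
have [s si] := Jchain_inhabited ik.
have sU : s \in U by apply/mem_Jupper; [lia | exists i => //; lia].
split; last first.
  move=> u v d [_ uU] [ud _].
  rewrite /word_depth [X in elt_depth _ _ _ X]thetaE in ud.
  by have [_ <-] := elt_depth_Jupper ud.
exists (letter (Sub s sU)), (letter (Sub s sU)); split=> //.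
by split; exists i; split; rewrite // [X in X \in _]thetaE.
Qed.

Lemma cayley_defines_of_has_pres_of_depth {d : int} :
  has_pres_of_depth eps k J d ->
  eps <= k - d + 1 <= k /\ cayley_defines (Jupper k J (k - d + 1)).
Proof.
move=> [A [R [theta [theta_bij [[u [v [Ruv [ud _]]]] d_max]]]]].
(* Some relation attains [d], so [d] is the depth of an element of S and the index is in range. *)
have [dk _] := elt_depth_Jupper ud; split=> //.
have thetaE w : weval (fun a => theta (wclass R (letter a))) w = theta (wclass R w).
  elim/(@word_rcons_ind A): w => [//|w a IHw].
  by rewrite wevalM IHw -[wclass R (w * _)%g]wclassM gmulfM.
have kernel x y : theta (wclass R x) = theta (wclass R y) <-> gen_congr R x y.
  split=> [/(bij_inj theta_bij)/wclassP//|xy].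
  by congr (theta _); apply/wclassP.
apply: (@cayley_defines_of_presentation S _ A R (fun a => theta (wclass R (letter a)))).
- exact: Jupper_factor_closed.
- move=> s; have [g _ gK] := theta_bij.
  by exists (wrepr (g s)); rewrite thetaE wreprK gK.
- by move=> x y; rewrite !thetaE.
move=> x y Rxy; rewrite thetaE; have [e xe] := elt_depth_ex (theta (wclass R x)).
have [_ ->] := elt_depth_Jupper xe; last by [].
(* The two sides represent the same element, so [e] is the depth of the relation and the maximality
   of [d] bounds it. *)
have := d_max _ _ e Rxy.
have -> : k - (k - d + 1) + 1 = d by lia.
apply; split=> //; rewrite /word_depth.
by rewrite -(iffRL (kernel x y) (gen_congr_rel Rxy)).
Qed.

End Chain.

(** * The largest defining index and the minimal depth *)

Theorem proposition3p1 (S : finSemigroupType) (eps k : int)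
    (J : int -> {set S}) (chainJ : Jchain eps k J) :
  exists i : int,
    [/\ eps <= i <= k,
        cayley_defines (Jupper k J i),
        (forall j : int,
           eps <= j <= k -> cayley_defines (Jupper k J j) -> j <= i)
      & relational_depth eps k J (k - i + 1)].
Proof.
(* Indices are counted downwards from [k], so the least [n] gives the largest index; the bound on
   [n] keeps [k - n] at least [eps]. *)
pose defines n := (n <= `|k - eps|)%N && `[< cayley_defines (Jupper k J (k - n%:Z)) >].
have [ek eps_defines] := (Jchain_ne chainJ, cayley_defines_Jupper_min chainJ).
have defines_int j : eps <= j <= k -> cayley_defines (Jupper k J j) ->
    defines `|k - j|%N.
  move=> jk jP; apply/andP; split; first lia.
  by apply/asboolP; rewrite (_ : k - _ = j) //; lia.
have ex_defines : exists n, defines n.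
  by exists `|k - eps|%N; apply: defines_int => //; lia.
case: (ex_minnP ex_defines) => n /andP[nk /asboolP nP] n_min.
have i_max j : eps <= j <= k -> cayley_defines (Jupper k J j) -> j <= k - n%:Z.
  by move=> jk /(defines_int j jk)/n_min; lia.
have ik : eps <= k - n%:Z <= k by lia.
exists (k - n%:Z); split=> //; split; first exact: has_pres_of_depth_Jupper.
(* A presentation of depth [d] makes [k - d + 1] a defining index, hence at most [k - n], which
   gives [d >= n + 1]. *)
move=> d /(cayley_defines_of_has_pres_of_depth chainJ)[dk /(i_max _ dk)].
lia.
Qed.
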